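(* Let $H$ be a tournament that is a left nebula or a right nebula. Then $\{H,H^{c}\}$ has the Erdős–Hajnal property; that is, there exists a constant $\kappa>0$ (depending only on $H$) such that every tournament $T$ that contains neither $H$ nor $H^{c}$ has a transitive subtournament of order at least $|T|^{\kappa}$.
   Context: All graphs and tournaments are finite and simple. A tournament is a directed graph in which for every two distinct vertices $u,v$ exactly one of $(u,v),(v,u)$ is an edge; $|T|$ denotes the number of vertices of $T$ (its order). A tournament is transitive if it has no directed cycle. A tournament $T$ contains a tournament $S$ if $S$ is isomorphic to the subtournament $T|X$ induced by some $X\subseteq V(T)$. The complement $H^{c}$ of a tournament $H$ is the tournament obtained from $H$ by reversing the directions of all edges. Let $\theta=(v_1,\dots,v_{|T|})$ be an ordering of the vertices of a tournament $T$. An edge $(v_j,v_i)$ of $T$ is a backward edge under $\theta$ if $i<j$. The graph of backward edges $B(T,\theta)$ is the undirected graph on $V(T)$ in which $v_iv_j$ is an edge if and only if $(v_i,v_j)$ or $(v_j,v_i)$ is a backward edge of $T$ under $\theta$. A three-vertex star is the graph $K_{1,2}$; its center is the vertex of degree 2. A connected component of $B(T,\theta)$ that is a three-vertex star is called a left star if its center precedes both other vertices in $\theta$, and a right star if its center comes after both other vertices in $\theta$. A tournament $T$ is a left nebula (respectively right nebula) if there is an ordering $\theta$ of its vertices such that every connected component of $B(T,\theta)$ is either a three-vertex left star (respectively right star) or a single vertex. *)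

(* Defs.v *)
From mathcomp Require Import all_boot all_order all_algebra.
From mathcomp Require Import reals exp.

Set Implicit Arguments.
Unset Strict Implicit.
Unset Printing Implicit Defensive.

Import Order.TTheory GRing.Theory Num.Theory.

Record tournament := Tournament {
  vertex :> finType;
  edge : rel vertex;
  edge_irrefl : irreflexive edge;
  edge_xor : forall u v, u != v -> edge u v (+) edge v u }.

Section Constructions.
Variable T : tournament.

Lemma edge_compl_xor (u v : T) :
  u != v -> edge v u (+) edge u v.
Proof. by rewrite eq_sym; apply: edge_xor. Qed.

Definition compl : tournament :=
  @Tournament T (fun u v => edge v u) (@edge_irrefl T) edge_compl_xor.

Variable X : {set T}.

Definition induced_edge : rel {x : T | x \in X} :=
  fun u v => edge (val u) (val v).

Lemma induced_edge_irrefl : irreflexive induced_edge.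
Proof. by move=> u; apply: edge_irrefl. Qed.

Lemma induced_edge_xor u v :
  u != v -> induced_edge u v (+) induced_edge v u.
Proof. by move=> uv; apply: edge_xor. Qed.

Definition induced : tournament :=
  Tournament induced_edge_irrefl induced_edge_xor.

End Constructions.

Definition isomorphic (S T : tournament) : Prop :=
  exists f : S -> T, bijective f /\ {mono f : u v / edge u v}.

Definition contains (T S : tournament) : Prop :=
  exists X : {set T}, isomorphic S (induced X).

(* [ucycle] also holds of the empty sequence, which is not a cycle. *)
Definition transitive_tournament (T : tournament) : Prop :=
  forall c : seq T, ucycle (@edge T) c -> c = [::].

Section Nebula.
Variables (T : tournament) (theta : seq T).

Definition ordering : Prop := perm_eq theta (enum T).

Definition precedes : rel T := fun u v => index u theta < index v theta.

Definition backward_edge : rel T := fun u v => edge u v && precedes v u.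

Definition backward_graph : rel T :=
  fun u v => backward_edge u v || backward_edge v u.

Definition component (x : T) : {set T} := [set y | connect backward_graph x y].

Definition three_star (C : {set T}) (c : T) : Prop :=
  exists a b : T,
    [/\ uniq [:: c; a; b], C = [set c; a; b], backward_graph c a,
        backward_graph c b & ~~ backward_graph a b].

Definition left_star (C : {set T}) : Prop :=
  exists c, three_star C c /\ {in C :\ c, forall u, precedes c u}.

Definition right_star (C : {set T}) : Prop :=
  exists c, three_star C c /\ {in C :\ c, forall u, precedes u c}.

End Nebula.

Definition left_nebula (T : tournament) : Prop :=
  exists2 theta : seq T, ordering theta &
    forall x : T,
      left_star theta (component theta x) \/ component theta x = [set x].

Definition right_nebula (T : tournament) : Prop :=
  exists2 theta : seq T, ordering theta &
    forall x : T,
      right_star theta (component theta x) \/ component theta x = [set x].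

Local Open Scope ring_scope.

Definition erdos_hajnal (R : realType) (F : tournament -> Prop) : Prop :=
  exists2 kappa : R, 0 < kappa &
    forall T : tournament, (forall S, F S -> ~ contains T S) ->
      exists X : {set T},
        transitive_tournament (induced X) /\
        #|T|%:R `^ kappa <= #|induced X|%:R.

(* Main.v *)
Require Import Defs.
From mathcomp Require Import all_boot all_order all_algebra.
From mathcomp Require Import reals exp.
From mathcomp Require Import zify boolp.

Set Implicit Arguments.
Unset Strict Implicit.
Unset Printing Implicit Defensive.

(** If a tournament contains neither [H] nor its complement, then every vertex set
    [S] with at least two elements has two subsets of size linear in [|S|], the
    first complete to the second; iterating this yields the power bound.

    Greedy embedding of [H] gives a long sequence of disjoint sets [A_i] of linear
    size such that every vertex sends or receives only few backward edges between
    [A_i] and [A_j]. If there is no linear complete pair, then any two linear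
    subsets of [A_i] and [A_j] span a backward edge. Given [i < j < k] and linear
    subsets of [A_i], [A_j], [A_k], one then finds a star with one vertex in each,
    either a left star centred in [A_i] or a right star centred in [A_k]. After
    shrinking the [A_i] and applying Ramsey's theorem for triples, the stars are
    of the same kind for all triples of a long subsequence. A left nebula is then
    embedded star by star; if the stars are right stars, reading the sequence
    backwards gives its complement. *)

(** * Ramsey's theorem *)

(** Induction on [k]. First thin the sequence so that the colour of a [k.+1]-subsequence depends
    only on its first entry, then keep the entries of the majority colour. *)
Lemma seq_ramsey k m : exists N, forall (col : seq nat -> bool) (s : seq nat),
  N <= size s -> exists t b, [/\ subseq t s, size t = m &
    forall u, subseq u t -> size u = k -> col u = b].
Proof.
elim: k m => [|k IHk] m.
  exists m => col s ms; exists (take m s), (col [::]).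
  split; [exact: take_subseq | by rewrite size_takel|].
  by move=> u _ /size0nil ->.
have [N HN] : exists N, forall (col : seq nat -> bool) (s : seq nat),
    N <= size s -> exists t (d : nat -> bool), [/\ subseq t s, size t = m.*2 &
      forall x u, subseq (x :: u) t -> size u = k -> col (x :: u) = d x].
  (* Build this sequence from the front: peel off [x], then use the case [k] for the colouring
     [col (x :: _)] to make the rest monochromatic before recursing into it. *)
  elim: m.*2 => [|n [N HN]].
    by exists 0 => col s _; exists [::], xpred0; split; rewrite ?sub0seq.
  have [N' HN'] := IHk N; exists N'.+1 => col [//|x s] /= ltNs.
  have [t [b [ts tN Ht]]] := HN' (fun u => col (x :: u)) s ltNs.
  have [t' [d [t't t'n Ht']]] := HN col t (eq_leq (esym tN)).
  exists (x :: t'), (fun y => if y == x then b else d y); split=> /=.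
  - by rewrite eqxx (subseq_trans t't).
  - by rewrite t'n.
  move=> y u; case: eqP => [-> ut' uk | _]; last exact: Ht'.
  by apply: Ht => //; apply: subseq_trans ut' t't.
exists N => col s /(HN col)[t [d [ts tm Ht]]].
have [b mb] : exists b, m <= size (filter (fun x => d x == b) t).
  have := count_predC d t; rewrite tm -!size_filter => sz.
  have [le|lt] := leqP m (size (filter d t)); [exists true | exists false].
    by rewrite (eq_filter (a2 := d)) // => x; rewrite eqb_id.
  rewrite (eq_filter (a2 := predC d)) => [|x]; last by rewrite /= eqbF_neg.
  by move: sz lt; rewrite -addnn; lia.
exists (take m (filter (fun x => d x == b) t)), b; split.
- by rewrite (subseq_trans _ ts) // (subseq_trans (take_subseq _ _)) // filter_subseq.
- by rewrite size_takel.
move=> u ut uk.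
have {ut} : subseq u (filter (fun x => d x == b) t).
  exact: subseq_trans ut (take_subseq _ _).
case: u uk => // x u [uk] sub.
rewrite (Ht x u) ?(subseq_trans sub) ?filter_subseq //.
by have /mem_subseq/(_ x) := sub; rewrite inE eqxx mem_filter => /(_ isT)/andP[/eqP].
Qed.

Lemma triple_ramsey m : exists N, forall col : nat -> nat -> nat -> bool,
  exists iota_ : nat -> nat, exists b,
    [/\ forall p q, p < q < m -> iota_ p < iota_ q,
        forall p, p < m -> iota_ p < N &
        forall p q r, p < q -> q < r < m -> col (iota_ p) (iota_ q) (iota_ r) = b].
Proof.
have [N HN] := seq_ramsey 3 m; exists N => col.
have [|t [b [ts tm Ht]]] := HN (fun u => col (nth 0 u 0) (nth 0 u 1) (nth 0 u 2)) (iota 0 N).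
  by rewrite size_iota.
have st : sorted ltn t by exact: (subseq_sorted ltn_trans ts (iota_ltn_sorted 0 N)).
have mono p q : p < q < m -> nth 0 t p < nth 0 t q.
  move=> /andP[pq qm]; apply: (sorted_ltn_nth ltn_trans 0 st) => //; rewrite inE tm //.
  exact: ltn_trans pq qm.
exists (nth 0 t), b; split=> // [p pm|p q r pq /andP[qr rm]].
  by have /(mem_subseq ts) : nth 0 t p \in t; rewrite ?mem_nth ?tm // mem_iota.
have qm := ltn_trans qr rm; have pm := ltn_trans pq qm.
apply: (Ht [:: nth 0 t p; nth 0 t q; nth 0 t r]) => //.
set u := [:: _; _; _].
(* Sorted sequences with the same entries coincide, so [u] is [t] filtered by membership in [u]. *)
suff -> : u = filter (mem u) t by apply: filter_subseq.
apply: (irr_sorted_eq ltn_trans ltnn).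
- by rewrite /= !mono ?pq ?qr.
- by apply: sorted_filter st => //; apply: ltn_trans.
move=> x; rewrite mem_filter /=.
case: (boolP (x \in u)) => //=; rewrite !inE => /or3P[]/eqP->;
  by rewrite mem_nth ?tm.
Qed.

(** * Induced stars between thin sets *)

Section Stars.
Variables (T : finType) (adj : rel T).
Hypothesis adj_sym : symmetric adj.
Implicit Types A B X Y Z : {set T}.

(** Neighbourhood density at most [1 / L], with denominators cleared so that all bounds stay in
    [nat]. *)
Definition thin L A B :=
  forall x, x \in A -> L * #|[set y in B | adj x y]| <= #|B|.

Definition linked E A B := forall X Y, X \subset A -> Y \subset B ->
  #|A| <= E * #|X| -> #|B| <= E * #|Y| -> exists x y, [/\ x \in X, y \in Y & adj x y].

(** The first set holds the centre. Boolean, so that it can serve as a colouring of triples. *)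
Definition has_star X Y Z :=
  [exists x in X, exists y in Y, exists z in Z, [&& adj x y, adj x z & ~~ adj y z]].

Lemma has_starP X Y Z : reflect
  (exists x y z, [/\ [/\ x \in X, y \in Y & z \in Z], adj x y, adj x z & ~~ adj y z])
  (has_star X Y Z).
Proof.
apply: (iffP exists_inP) => [[x xX /exists_inP[y yY /exists_inP[z zZ /and3P[]]]]|].
  by exists x, y, z.
move=> [x [y [z [[xX yY zZ] xy xz yz]]]]; exists x => //.
apply/exists_inP; exists y => //; apply/exists_inP; exists z => //.
by rewrite xy xz.
Qed.

Lemma has_starC X Y Z : has_star X Y Z = has_star X Z Y.
Proof.
by apply/has_starP/has_starP => -[x [y [z [[? ? ?] ? ? yz]]]]; exists x, z, y;
  rewrite adj_sym in yz.
Qed.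

Lemma has_starS X Y Z X' Y' Z' : X \subset X' -> Y \subset Y' -> Z \subset Z' ->
  has_star X Y Z -> has_star X' Y' Z'.
Proof.
move=> /subsetP sX /subsetP sY /subsetP sZ /has_starP[x [y [z [[? ? ?] ? ? ?]]]].
by apply/has_starP; exists x, y, z; split=> //; split; [exact: sX|exact: sY|exact: sZ].
Qed.

Definition nbhd Z X := [set x in X | [exists z in Z, adj z x]].

(* Take [Z] in the middle set minimal such that [Z] reaches a third of one of
   the outer sets; by thinness it then misses a third of the other one. *)
Lemma star_left_or_right D L A1 A2 A3 X1 X2 X3 :
  0 < L -> 3 * D <= L -> X1 \subset A1 -> X2 \subset A2 -> X3 \subset A3 ->
  0 < #|A1| -> 0 < #|A3| ->
  #|A1| <= D * #|X1| -> #|A2| <= D * #|X2| -> #|A3| <= D * #|X3| ->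
  thin L A2 A1 -> thin L A2 A3 -> linked (3 * D) A1 A2 -> linked (3 * D) A1 A3 ->
  has_star X1 X2 X3 || has_star X3 X1 X2.
Proof.
move=> L0 DL s1 s2 s3 A1gt A3gt c1 c2 c3 thin1 thin3 link12 link13.
pose P Z := (Z \subset X2) && ((#|X1| <= 3 * #|nbhd Z X1|) || (#|X3| <= 3 * #|nbhd Z X3|)).
have split_nbhd Z X : #|X| = #|nbhd Z X| + #|X :\: nbhd Z X|.
  by rewrite (cardsD X) (setIidPr _) ?subsetDl ?subnKC ?subset_leq_card //;
    apply/subsetP => x; rewrite inE => /andP[].
(* Otherwise a linear part of [X1] would have no neighbour in [X2], against [link12]. *)
have PX2 : P X2.
  rewrite /P subxx /=; apply/orP; left; rewrite leqNgt; apply/negP => lt.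
  have [||||x [y [xX yX xy]]] := link12 (X1 :\: nbhd X2 X1) X2.
  - by rewrite (subset_trans _ s1) ?subsetDl.
  - by [].
  - have := split_nbhd X2 X1; nia.
  - nia.
  move: xX; rewrite !inE => /andP[/negP + x1]; apply; rewrite x1 /=.
  by apply/exists_inP; exists y; rewrite // adj_sym.
have [Z /minsetP[/andP[ZX2 PZ] Zmin]] : {Z | minset P Z} by apply: ex_minset; exists X2.
have [z zZ] : exists z, z \in Z.
  apply/set0Pn/eqP => Z0; move: PZ; rewrite Z0.
  have nb0 X : #|nbhd set0 X| = 0.
    apply: eq_card0 => x; rewrite !inE; apply/negP => /andP[_ /exists_inP[z]].
    by rewrite inE.
  by rewrite !nb0 !muln0; case/orP; nia.
(* Restoring [z] enlarges the neighbourhood by at most [#|A| / L], hence by at most a third of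
   [X]. *)
have small X A : X \subset A -> #|A| <= D * #|X| -> thin L A2 A ->
    3 * #|nbhd (Z :\ z) X| < #|X| -> #|X| <= 3 * #|X :\: nbhd Z X|.
  move=> sXA cX /(_ z) thinz lt.
  have {thinz} := thinz (subsetP s2 _ (subsetP ZX2 _ zZ)).
  have : #|nbhd Z X| <= #|nbhd (Z :\ z) X| + #|[set y in A | adj z y]|.
    apply: leq_trans (leq_card_setU _ _); apply/subset_leq_card/subsetP => x.
    rewrite !inE => /andP[xX /exists_inP[w wZ wx]]; rewrite xX (subsetP sXA) //=.
    have [<-|wz] := eqVneq w z; first by rewrite wx orbT.
    by apply/orP; left; apply/exists_inP; exists w; rewrite // !inE wz.
  have := split_nbhd Z X; move: lt; set a := #|nbhd _ X|; set b := #|nbhd Z X|.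
  set c := #|X :\: _|; set d := #|[set y in A | _]| => lt eX ub dA.
  suff: 3 * d <= #|X| by lia.
  rewrite -(leq_pmul2l L0); apply: leq_trans (_ : 3 * #|A| <= _); first by nia.
  by apply: leq_trans (_ : (3 * D) * #|X| <= _); nia.
have /norP[] : ~~ ((#|X1| <= 3 * #|nbhd (Z :\ z) X1|) || (#|X3| <= 3 * #|nbhd (Z :\ z) X3|)).
  apply/negP => PZz; have := Zmin (Z :\ z).
  rewrite /P PZz (subset_trans (subsetDl _ _) ZX2) subsetDl => /(_ isT isT) ZE.
  by move: zZ; rewrite -ZE !inE eqxx.
rewrite -!ltnNge => /(small _ _ s1 c1 thin1) large1 /(small _ _ s3 c3 thin3) large3.
have nbS Y A : Y \subset A -> nbhd Z Y \subset A.
  by apply: subset_trans; apply/subsetP => x; rewrite inE => /andP[].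
have DS Y A : Y \subset A -> Y :\: nbhd Z Y \subset A.
  by apply: subset_trans; apply: subsetDl.
(* An edge from the reached part of one outer set to the missed part of the other, together with a
   vertex of [Z] adjacent to its reached end, is an induced star centred at that end. *)
case/orP: PZ => [n1|n3]; apply/orP; [left|right].
  have [||||x [y [+ + xy]]] := link13 (nbhd Z X1) (X3 :\: nbhd Z X3); [exact: nbS|exact: DS|nia|nia|].
  rewrite !inE => /andP[x1 /exists_inP[w wZ wx]] /andP[/nandP[/negP//|nw] y3].
  apply/has_starP; exists x, w, y; split=> //; last 2 first.
  - by rewrite adj_sym.
  - by apply: contra nw => wy; apply/exists_inP; exists w.
  by split=> //; apply: (subsetP ZX2).
have [||||x [y [+ + xy]]] := link13 (X1 :\: nbhd Z X1) (nbhd Z X3); [exact: DS|exact: nbS|nia|nia|].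
rewrite !inE => /andP[/nandP[/negP//|nw] x1] /andP[y3 /exists_inP[w wZ wy]].
apply/has_starP; exists y, x, w; split=> //; [|by rewrite adj_sym|by rewrite adj_sym|].
  by split=> //; apply: (subsetP ZX2).
by rewrite adj_sym; apply: contra nw => wx; apply/exists_inP; exists w.
Qed.

(** Stars must survive every shrinking by a factor [M]; this leaves room to embed several stars one
    after another. *)
Definition robust_star M (X : nat -> {set T}) i j k := forall Y : nat -> {set T},
  (forall p, Y p \subset X p) -> (forall p, #|X p| <= M * #|Y p|) ->
  has_star (Y i) (Y j) (Y k).

Lemma robust_starP M (X : nat -> {set T}) i j k : robust_star M X i j k \/
  exists Y : nat -> {set T}, [/\ forall p, Y p \subset X p,
    forall p, #|X p| <= M * #|Y p| & ~~ has_star (Y i) (Y j) (Y k)].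
Proof.
have [|/existsNP[Y H]] := EM (robust_star M X i j k); [by left|right; exists Y].
by move: H; rewrite !not_implyE => -[? [? /negP ?]].
Qed.

End Stars.

(* The tail of [ts] is treated at level [M * M], so that its robustness survives
   one more shrinking by [M] for the head. *)
Lemma robust_or_star_free M (ts : seq (nat * nat * nat)) : 0 < M ->
  exists2 E, 0 < E & forall (T : finType) (adj : rel T) (A : nat -> {set T}),
  exists X : nat -> {set T},
  [/\ forall p, X p \subset A p, forall p, #|A p| <= E * #|X p| &
    forall i j k, (i, j, k) \in ts ->
      robust_star adj M X i j k \/ ~~ has_star adj (X i) (X j) (X k)].
Proof.
elim: ts M => [|[[i j] k] ts IHts] M M0.
  by exists 1 => // T adj A; exists A; split=> // p; rewrite mul1n.
have [|E E0 HE] := IHts (M * M); first by rewrite muln_gt0 M0.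
exists (M * E) => [|T adj A]; first by rewrite muln_gt0 M0.
have [X [XA cX HX]] := HE T adj A.
have [rob|[Y [YX cY nY]]] := robust_starP adj M X i j k.
  exists X; split=> // [p|i' j' k'].
    by apply: leq_trans (cX p) _; rewrite leq_mul2r leq_pmull ?orbT.
  rewrite inE => /orP[/eqP[-> -> ->]|/HX[robX|]]; [by left| |by right].
  left=> Y YX cY; apply: robX => // p; apply: leq_trans (cY p) _.
  by rewrite leq_mul2r leq_pmull ?orbT.
exists Y; split=> [p|p|i' j' k'].
- exact: subset_trans (YX p) (XA p).
- by rewrite (mulnC M) -mulnA (leq_trans (cX p)) // leq_mul2l cY orbT.
rewrite inE => /orP[/eqP[-> -> ->]|/HX[robX|nX]]; [by right| |right].
  left=> Z ZY cZ; apply: robX => p; first exact: subset_trans (ZY p) (YX p).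
  by apply: leq_trans (cY p) _; rewrite -mulnA leq_mul2l cZ orbT.
by apply: contra nX; apply: has_starS.
Qed.

(** Colour a triple by whether the shrunk sets contain a star centred in the first. If they do, the
    star is robust by [robust_or_star_free]. If not, no smaller sets do either, so
    [star_left_or_right] yields a star centred in the last set after every shrinking, and robustness
    is automatic. *)
Lemma homogeneous_stars h M : 0 < M -> exists N E, 0 < E /\
  forall (T : finType) (adj : rel T) (A : nat -> {set T}) L,
  symmetric adj -> 3 * (E * M) <= L -> (forall i, i < N -> 0 < #|A i|) ->
  (forall i j, i < N -> j < N -> i != j -> thin adj L (A i) (A j)) ->
  (forall i j, i < j -> j < N -> linked adj (3 * (E * M)) (A i) (A j)) ->
  exists (X : nat -> {set T}) (iota_ : nat -> nat),
  [/\ forall p, X p \subset A p, forall p, #|A p| <= E * #|X p|,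
      forall p q, p < q < h -> iota_ p < iota_ q,
      forall p, p < h -> iota_ p < N &
      (forall p q r, p < q -> q < r < h -> robust_star adj M X (iota_ p) (iota_ q) (iota_ r)) \/
      (forall p q r, p < q -> q < r < h -> robust_star adj M X (iota_ r) (iota_ p) (iota_ q))].
Proof.
move=> M0; have [N HN] := triple_ramsey h.
pose I := iota 0 N.
pose ts := [seq (ij, k) | ij <- [seq (i, j) | i <- I, j <- I], k <- I].
have [E E0 HE] := robust_or_star_free ts M0.
exists N, E; split=> // T adj A L adj_sym leL A0 thinA linkA.
have [X [XA cX HX]] := HE T adj A.
have [i_ [b [mono bound Hb]]] := HN (fun i j k => has_star adj (X i) (X j) (X k)).
exists X, i_; split=> //; case: b Hb => Hb; [left|right] => p q r pq qrh.
  have [qr rh] := andP qrh; have qh := ltn_trans qr rh; have ph := ltn_trans pq qh.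
  have [|//|] := HX (i_ p) (i_ q) (i_ r); last by rewrite Hb.
  by apply: allpairs_f; [apply: allpairs_f|]; rewrite mem_iota bound.
have [qr rh] := andP qrh; have qh := ltn_trans qr rh; have ph := ltn_trans pq qh.
move=> Y YX cY.
have pqi : i_ p < i_ q by rewrite mono // pq.
have qri : i_ q < i_ r by rewrite mono // qr.
have pri := ltn_trans pqi qri.
have YA i : Y i \subset A i := subset_trans (YX i) (XA i).
have cYA i : #|A i| <= E * M * #|Y i|.
  by rewrite (leq_trans (cX i)) // -mulnA leq_mul2l cY orbT.
have := @star_left_or_right T adj adj_sym (E * M) L (A (i_ p)) (A (i_ q)) (A (i_ r))
  (Y (i_ p)) (Y (i_ q)) (Y (i_ r)).
case/(_ _ _ _ _ _ _ _ _ _ _ _ _ _ _)/orP => //; rewrite ?A0 ?bound //.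
- by apply: leq_trans leL; rewrite !muln_gt0 E0 M0.
- by apply: thinA; rewrite ?bound // gtn_eqF.
- by apply: thinA; rewrite ?bound // ltn_eqF.
- by apply: linkA; rewrite ?bound.
- by apply: linkA; rewrite ?bound.
by move/(has_starS (YX _) (YX _) (YX _)); rewrite Hb.
Qed.

(** The components of [g] are embedded one at a time, deleting from the remaining sets all
    neighbours of the chosen vertices. At most three vertices are chosen per round, each with at
    most [#|X v| / (6 * M) <= #|Y v| / 6] neighbours, so a current set [Y v] loses at most half.
    There are at most [#|V|] rounds, whence [2 ^ #|V| <= M]. *)
Lemma embed_stars (T : finType) (adj : rel T) (V : finType) (g : rel V)
    (X : V -> {set T}) M :
  symmetric adj -> symmetric g -> 0 < M -> (forall v, 0 < #|X v|) ->
  (forall u v, u != v -> thin adj (6 * M) (X u) (X v)) ->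
  (forall x, (forall v, v != x -> ~~ g x v) \/
     exists c a b, let C := [set c; a; b] in
       [/\ x \in C, uniq [:: c; a; b], [/\ g c a, g c b & ~~ g a b],
           forall u v, u \in C -> v \notin C -> ~~ g u v &
           forall Y : V -> {set T}, (forall v, Y v \subset X v) ->
             (forall v, #|X v| <= M * #|Y v|) -> has_star adj (Y c) (Y a) (Y b)]) ->
  2 ^ #|V| <= M ->
  exists f : V -> T, (forall v, f v \in X v) /\
    forall u v, u != v -> adj (f u) (f v) = g u v.
Proof.
move=> adj_sym g_sym M0 X0 thinX Hg leM.
have f0 v : exists y, y \in X v by apply/card_gt0P.
(* [U] is a union of components still to be embedded; the bound on [Y] leaves room for [n] more
   halvings. *)
suff main n (U : {set V}) (Y : V -> {set T}) : #|U| <= n ->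
    (forall u v, u \in U -> g u v -> v \in U) ->
    (forall v, Y v \subset X v) -> (forall v, #|X v| * 2 ^ n <= M * #|Y v|) ->
    exists f : V -> T, (forall v, v \in U -> f v \in Y v) /\
    {in U &, forall u v, u != v -> adj (f u) (f v) = g u v}.
  have [||||f [fX fg]] := main #|V| setT X => //.
  - by rewrite cardsT.
  - by move=> v; rewrite mulnC leq_mul2r leM orbT.
  by exists f; split=> [v|u v uv]; [apply: fX|apply: fg]; rewrite ?inE.
elim: n U Y => [|n IHn] U Y leU clU YX cY.
  move: leU; rewrite leqn0 cards_eq0 => /eqP->.
  by exists (fun v => xchoose (f0 v)); split=> u; rewrite inE.
have [->|/set0Pn[x xU]] := eqVneq U set0.
  by exists (fun v => xchoose (f0 v)); split=> u; rewrite inE.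
have cY1 v : #|X v| <= M * #|Y v|.
  by apply: leq_trans (cY v); rewrite leq_pmulr ?expn_gt0.
have [C [fC [xC CU leC [clC fCY fCg]]]] : exists (C : {set V}) (fC : V -> T),
    [/\ x \in C, C \subset U, #|C| <= 3 &
     [/\ forall u v, u \in C -> v \notin C -> ~~ g u v,
       forall v, v \in C -> fC v \in Y v &
       {in C &, forall u v, u != v -> adj (fC u) (fC v) = g u v}]].
  have [single|[c [a [b [xC]]]]] := Hg x.
    have /card_gt0P[y yY] : 0 < #|Y x| by move: (X0 x) (cY1 x); nia.
    exists [set x], (fun=> y); split; rewrite ?inE ?sub1set ?cards1 //; split.
    - by move=> u v; rewrite !inE => /eqP-> /single.
    - by move=> v; rewrite inE => /eqP->.
    - by move=> u v; rewrite !inE => /eqP-> /eqP->; rewrite eqxx.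
  rewrite /= !inE => /and3P[/norP[ca cb] ab _] [gca gcb gab] clC robust.
  have [yc [ya [yb [[ycY yaY ybY] yca ycb yab]]]] := has_starP _ _ _ _ (robust Y YX cY1).
  pose fC v := if v == c then yc else if v == a then ya else yb.
  have [gac gbc] : g a c /\ g b c by rewrite !(g_sym _ c).
  have fc : fC c = yc by rewrite /fC eqxx.
  have fa : fC a = ya by rewrite /fC eq_sym (negbTE ca) eqxx.
  have fb : fC b = yb by rewrite /fC eq_sym (negbTE cb) eq_sym (negbTE ab).
  exists [set c; a; b], fC; split=> //.
  - have cU : c \in U.
      move: xC; rewrite !inE => /orP[/orP[]|] /eqP xE; rewrite xE // in xU.
      + exact: clU xU gac.
      + exact: clU xU gbc.
    apply/subsetP => v; rewrite !inE => /orP[/orP[]|] /eqP-> //.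
    + exact: clU cU gca.
    + exact: clU cU gcb.
  - by rewrite (leq_trans (leq_card_setU _ _)) // cards1 cards2; case: (_ != _).
  split=> //.
    by move=> v; rewrite !inE => /orP[/orP[]|] /eqP->; rewrite ?fc ?fa ?fb.
  have sym' u v : adj (fC u) (fC v) = g u v -> adj (fC v) (fC u) = g v u.
    by rewrite adj_sym g_sym.
  have Eca : adj (fC c) (fC a) = g c a by rewrite fc fa gca yca.
  have Ecb : adj (fC c) (fC b) = g c b by rewrite fc fb gcb ycb.
  have Eab : adj (fC a) (fC b) = g a b by rewrite fa fb (negbTE gab) (negbTE yab).
  move=> u v; rewrite !inE => /orP[/orP[]|] /eqP-> /orP[/orP[]|] /eqP->;
    by rewrite ?eqxx // => _; first [done | apply: sym'].
pose bad v := \bigcup_(u in C) [set y in X v | adj (fC u) y].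
pose Y' v := if v \in C then Y v else Y v :\: bad v.
have Y'Y v : Y' v \subset Y v by rewrite /Y'; case: ifP => _; rewrite ?subsetDl.
have cY' v : #|Y v| <= 2 * #|Y' v|.
  rewrite /Y'; case: ifPn => vC; first by rewrite leq_pmull.
  have : 2 * #|bad v| <= #|Y v|.
    have : #|bad v| <= \sum_(u in C) #|[set y in X v | adj (fC u) y]|.
      rewrite /bad; elim/big_rec2: _ => [|u m S _ leS]; first by rewrite cards0.
      by rewrite (leq_trans (leq_card_setU _ _)) // leq_add2l.
    have : 6 * M * \sum_(u in C) #|[set y in X v | adj (fC u) y]| <= #|C| * #|X v|.
      rewrite big_distrr -sum_nat_const /=; apply: leq_sum => u uC; apply: (thinX u).
        by apply: contraNneq vC => <-.
      by apply: (subsetP (YX u)); apply: fCY.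
    set S := \sum_(u in C) _; have := cY1 v; move: leC M0; nia.
  have : #|Y v| <= #|bad v| + #|Y v :\: bad v|.
    apply: leq_trans (leq_card_setU _ _); apply: subset_leq_card.
    by apply/subsetP => y; rewrite !inE => ->; case: (y \in bad v).
  lia.
have [||||f [fY fg]] := IHn (U :\: C) Y'.
- have := cardsD U C; rewrite (setIidPr CU).
  have : 0 < #|C| by apply/card_gt0P; exists x.
  by move: leU; lia.
- move=> u v; rewrite !inE => /andP[uC uU] guv; rewrite (clU u) // andbT.
  by apply: contraL guv => vC; rewrite g_sym clC.
- by move=> v; apply: subset_trans (Y'Y v) (YX v).
- move=> v; have := cY v; have := cY' v; rewrite expnS; nia.
have fYv v : v \in U -> v \notin C -> f v \in Y v :\: bad v.
  by move=> vU vC; have := fY v; rewrite /Y' inE (negbTE vC) vU => /(_ isT).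
have Hcross u v : u \in C -> v \in U -> v \notin C -> adj (fC u) (f v) = g u v.
  move=> uC vU vC; rewrite (negbTE (clC _ _ uC vC)); apply/negbTE/negP => adjuv.
  have := fYv v vU vC; rewrite inE => /andP[/bigcupP[]]; exists u => //.
  by rewrite inE adjuv andbT (subsetP (YX v)) //; have /setDP[] := fYv v vU vC.
exists (fun v => if v \in C then fC v else f v); split.
  move=> v vU; case: ifPn => vC; first exact: fCY.
  by have /setDP[] := fYv v vU vC.
move=> u v uU vU uv; case: ifPn => uC; case: ifPn => vC.
- exact: fCg.
- exact: Hcross.
- by rewrite adj_sym g_sym Hcross.
- by apply: fg; rewrite // inE ?uC ?vC.
Qed.

(** * Sparse sequences of sets *)

Lemma edgeC (T : tournament) (u v : T) : u != v -> edge u v = ~~ edge v u.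
Proof. by move=> /edge_xor; case: edge; case: edge. Qed.

Lemma edge_neq (T : tournament) (u v : T) : edge u v -> u != v.
Proof. by apply: contraTneq => ->; rewrite edge_irrefl. Qed.

Definition embeds (H T : tournament) := exists f : H -> T, {mono f : u v / edge u v}.

(** Injectivity comes for free: distinct [u] and [v] are joined by an edge, which [f u = f v] would
    turn into a loop. *)
Lemma embeds_contains H T : embeds H T -> contains T H.
Proof.
move=> [f fE].
have f_inj : injective f.
  move=> u v fuv; apply: contraTeq isT => /[dup] uv /edgeC.
  by rewrite -!fE fuv edge_irrefl.
pose X := f @: [set: H].
have fX u : f u \in X by rewrite imset_f.
exists X, (fun u => exist _ (f u) (fX u)).
split; last exact: fE.
apply: inj_card_bij => [u v [/f_inj]//|].
by rewrite card_sig (card_imset _ f_inj) cardsT.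
Qed.

Lemma subset_of_card (T : finType) (A : {set T}) q :
  q <= #|A| -> exists2 B : {set T}, B \subset A & #|B| = q.
Proof.
move=> /card_geqP[s [us sq sA]]; exists [set x in s].
  by apply/subsetP => x; rewrite inE; apply: sA.
by rewrite cardsE (card_uniqP us).
Qed.

Lemma sum_pigeonhole (I : eqType) (s : seq I) (F : I -> nat) n : 0 < n ->
  n <= \sum_(i <- s) F i -> exists2 i, i \in s & n <= size s * F i.
Proof.
move=> n0 le; have [/hasP[i]|/hasPn Hs] := boolP (has (fun i => n <= size s * F i) s).
  by exists i.
have: size s * (\sum_(i <- s) F i) <= \sum_(i <- s) n.-1.
  rewrite big_distrr /= big_seq_cond [leqRHS]big_seq_cond; apply: leq_sum => i.
  by rewrite andbT => /Hs; rewrite -ltnNge; lia.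
rewrite big_const_seq count_predT iter_addn_0.
case: s le {Hs} => [|i s]; first by rewrite big_nil; lia.
set S := \sum_(_ <- _) _ => le; rewrite mulnC leq_mul2r /=; lia.
Qed.

(** Double counting: each discarded [y] is related to more than [#|X| / L] elements, while there are
    at most [#|X| * #|Y| / (2 * L)] related pairs in all. *)
Lemma exists_sparse_half (T : finType) (R : rel T) (X Y : {set T}) L : 0 < L ->
  (forall x, x \in X -> 2 * L * #|[set y in Y | R x y]| <= #|Y|) ->
  exists2 Y' : {set T}, Y' \subset Y & #|Y| <= 2 * #|Y'| /\
    forall y, y \in Y' -> L * #|[set x in X | R x y]| <= #|X|.
Proof.
move=> L0 HX; pose Y' := [set y in Y | L * #|[set x in X | R x y]| <= #|X|].
have Y'Y : Y' \subset Y by apply/subsetP => y; rewrite inE => /andP[].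
exists Y' => //; split=> [|y]; last by rewrite inE => /andP[].
have [X0|/card_gt0P X0] := posnP #|X|.
  suff -> : Y' = Y by rewrite leq_pmull.
  apply/setP => y; rewrite inE X0 leqn0 muln_eq0 cards_eq0 orbC.
  rewrite (_ : [set x in X | R x y] = set0) ?eqxx ?andbT //.
  by apply/setP => x; rewrite !inE (cards0_eq X0) inE.
have {X0} X0 : 0 < #|X| by apply/card_gt0P.
have double : \sum_(x in X) #|[set y in Y | R x y]| = \sum_(y in Y) #|[set x in X | R x y]|.
  under eq_bigr => x _ do rewrite -sum1dep_card big_mkcondr.
  rewrite exchange_big /=; apply: eq_bigr => y _.
  by rewrite -sum1dep_card big_mkcondr.
have up : 2 * (L * \sum_(x in X) #|[set y in Y | R x y]|) <= #|X| * #|Y|.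
  by rewrite mulnA big_distrr -sum_nat_const /=; apply: leq_sum.
have low : #|Y :\: Y'| * #|X| <= L * \sum_(x in X) #|[set y in Y | R x y]|.
  rewrite double big_distrr /= -sum_nat_const [leqRHS](big_setID Y') /=.
  rewrite (setIidPr Y'Y); apply: leq_trans (leq_addl _ _).
  apply: leq_sum => y; rewrite !inE => /andP[+ yY].
  by rewrite yY /= -ltnNge => /ltnW.
have := cardsD Y Y'; rewrite (setIidPr Y'Y); have := subset_leq_card Y'Y.
set a := #|Y'|; set b := #|Y| in up *; set c := #|Y :\: Y'| in low *.
move: up low X0; set S := L * _; set m := #|X| => up low X0 ab cE.
have : 2 * c * m <= b * m by nia.
by rewrite leq_pmul2r //; lia.
Qed.

(** [X] is thought of as coming before [Y], so the edges counted are the backward ones. *)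
Definition sparse (T : tournament) L (X Y : {set T}) :=
  (forall x, x \in X -> L * #|[set y in Y | edge y x]| <= #|Y|) /\
  (forall y, y \in Y -> L * #|[set x in X | edge y x]| <= #|X|).

(* Embed the first vertex so that all later candidate sets lose at most a factor
   [L]; if this is impossible, some later set is bad for a linear part of [V u]. *)
Lemma embeds_or_one_sided (H : tournament) L (s : seq H) C : 0 < C -> 0 < L ->
  exists2 K, 0 < K & forall (T : tournament) (V : H -> {set T}) n, 0 < n -> uniq s ->
  (forall v, v \in s -> n <= C * #|V v|) -> (forall v, V v != set0) ->
  (exists f : H -> T, (forall v, v \in s -> f v \in V v) /\
    {in s &, {mono f : u v / edge u v}}) \/
  (exists u v (X : {set T}), [/\ X \subset V u, n <= K * #|X| &
    exists Y : {set T}, [/\ Y \subset V v, n <= K * #|Y| &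
    exists b : bool, forall x, x \in X ->
      L * #|[set y in Y | if b then edge x y else edge y x]| <= #|Y|]]).
Proof.
move=> C0 L0; elim: s C C0 => [|u s IHs] C C0.
  exists 1 => // T V n _ _ _ V0; left.
  have V0' v : exists x, x \in V v by apply/set0Pn.
  by exists (fun v => xchoose (V0' v)); split=> // v; rewrite in_nil.
have [|K K0 HK] := IHs (L * C); first by rewrite muln_gt0 L0.
exists (K + C * (size s).+1) => [|T V n n0 /= /andP[us uniq_s] cV V0].
  by rewrite addn_gt0 K0.
(* The vertices of [V v] that see [x] the way [v] sees [u]. *)
pose W v x := [set y in V v | if edge u v then edge x y else edge y x].
pose good x v := #|V v| <= L * #|W v x|.
have [/existsP[x /andP[xV /allP xgood]]|/existsPn Hbad] :=
    boolP [exists x, (x \in V u) && all (good x) s].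
  pose V' v := if v \in s then W v x else V v.
  have cV' v : v \in s -> n <= L * C * #|V' v|.
    move=> vs; rewrite /V' vs (leq_trans (cV v _)) ?inE ?vs ?orbT //.
    by rewrite (mulnC L) -mulnA leq_mul2l; apply/orP; right; apply: xgood.
  have V'0 v : V' v != set0.
    case: (boolP (v \in s)) => vs; last by rewrite /V' (negbTE vs).
    by rewrite -card_gt0; have := cV' v vs; case: #|V' v| => //; lia.
  have V'V v : V' v \subset V v.
    by rewrite /V'; case: ifP => // _; apply/subsetP => y; rewrite inE => /andP[].
  have [[f [fV fE]]|[a [b [X [XV cX [Y [YV cY HXY]]]]]]] :=
    HK T V' n n0 uniq_s cV' V'0; [left|right].
    exists (fun v => if v == u then x else f v); split=> [v|v w].
      by rewrite inE; case: eqP => [-> //|_] /= vs; rewrite (subsetP (V'V v)) ?fV.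
    have adj v' : v' \in s -> edge x (f v') = edge u v' /\ edge (f v') x = edge v' u.
      move=> vs; have uv : u != v' by apply: contraNneq us => ->.
      have := fV v' vs; rewrite /V' vs inE => /andP[_].
      rewrite (edgeC uv); case: (boolP (edge v' u)) => /= _ e.
        by rewrite (edgeC (_ : x != f v')) ?e // eq_sym (edge_neq e).
      by rewrite (edgeC (_ : f v' != x)) ?e // eq_sym (edge_neq e).
    rewrite !inE; case: eqP => [->|_] /=; case: eqP => [->|_] //=.
    - by rewrite !edge_irrefl.
    - by move=> _ /adj[].
    - by move=> /adj[].
    - exact: fE.
  exists a, b, X; split.
  - exact: subset_trans XV (V'V a).
  - by rewrite (leq_trans cX) // leq_mul2r leq_addr orbT.
  exists Y; split=> //; first exact: subset_trans YV (V'V b).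
  by rewrite (leq_trans cY) // leq_mul2r leq_addr orbT.
right.
(* No [x] in [V u] is good for all of [s], so the bad sets cover [V u] and one of them is linear. *)
pose B v := [set x in V u | ~~ good x v].
have Vu0 : 0 < #|V u| by rewrite card_gt0.
have [|v vs cB] := sum_pigeonhole (s := s) (F := fun v => #|B v|) Vu0.
  apply: (@leq_trans #|\bigcup_(v <- s) B v|).
    apply/subset_leq_card/subsetP => x xV; have := Hbad x.
    rewrite xV /= -has_predC => /hasP[v vs vbad].
    by rewrite bigcup_seq; apply/bigcupP; exists v; rewrite // inE xV.
  elim/big_rec2: _ => [|i m S _ leS]; first by rewrite cards0.
  by rewrite (leq_trans (leq_card_setU _ _)) // leq_add2l.
exists u, v, (B v); split.
- by apply/subsetP => x; rewrite inE => /andP[].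
- apply: leq_trans (cV u _) _; first by rewrite inE eqxx.
  apply: leq_trans (_ : C * (size s * #|B v|) <= _); first by rewrite leq_mul2l cB orbT.
  by rewrite mulnA leq_mul2r mulnS addnA leq_addl orbT.
exists (V v); split=> //.
  apply: leq_trans (cV v _) _; rewrite ?inE ?vs ?orbT //.
  by rewrite leq_mul2r mulnS addnCA leq_addr orbT.
exists (edge u v) => x; rewrite inE => /andP[_].
by rewrite /good -ltnNge => /ltnW.
Qed.

(** With all candidate sets equal to [S], the failure to embed [H] gives a pair that may overlap and
    is sparse from one side only. Making it disjoint and then applying [exists_sparse_half] cost a
    factor 2 each, hence [4 * L] at the start. *)
Lemma exists_sparse_pair (H : tournament) L : 0 < L ->
  exists2 K, 0 < K & forall (T : tournament) (S : {set T}), ~ embeds H T -> K <= #|S| ->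
  exists X Y : {set T}, [/\ X \subset S, Y \subset S, [disjoint X & Y],
    #|S| <= K * #|X| /\ #|S| <= K * #|Y| & sparse L X Y].
Proof.
move=> L0; have [K K0 HK] := @embeds_or_one_sided H (4 * L) (enum H) 1 isT ltac:(lia).
exists (6 * K) => [|T S nH leS]; first by rewrite muln_gt0.
have S0 : 0 < #|S| by lia.
have [||[f [_ fE]]|] := HK T (fun=> S) #|S| S0 (enum_uniq H).
- by move=> v _; rewrite mul1n.
- by move=> v; rewrite -card_gt0.
- by case: nH; exists f => u v; apply: fE; rewrite mem_enum.
move=> [_ [_ [X [XS cX [Y [YS cY [b Hb]]]]]]].
(* Capping [X'] at half of [Y] ensures that its removal leaves at least half of [Y]. *)
have [|X' X'X cX'] := @subset_of_card T X (minn #|X| (#|Y|./2)); first exact: geq_minl.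
pose Y1 := Y :\: X'.
have halfY : #|Y|./2.*2 <= #|Y| by rewrite -[leqRHS]odd_double_half leq_addl.
have halfY' : #|Y| <= #|Y|./2.*2.+1.
  by rewrite -[leqLHS]odd_double_half; case: odd; rewrite ?add1n ?add0n.
have cY1 : #|Y| <= 2 * #|Y1|.
  have : #|Y| <= #|X'| + #|Y1|.
    apply: leq_trans (leq_card_setU _ _); apply/subset_leq_card/subsetP => y.
    by rewrite !inE => ->; case: (y \in X').
  by have := geq_minr #|X| #|Y|./2; rewrite -cX'; lia.
pose R x y := if b then edge x y else @edge T y x.
have [|x xX|Y' Y'Y [cY' HY']] := @exists_sparse_half T R X' Y1 L.
- by [].
- have := Hb x (subsetP X'X x xX).
  have : #|[set y in Y1 | R x y]| <= #|[set y in Y | R x y]|.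
    apply/subset_leq_card/subsetP => y; rewrite !inE => /andP[/andP[_ ->]].
    by move=> ->.
  by rewrite /R; nia.
have Y'S : Y' \subset S.
  by rewrite (subset_trans Y'Y) // (subset_trans (subsetDl _ _)).
have X'S := subset_trans X'X XS.
have disj : [disjoint X' & Y'].
  rewrite disjoint_subset; apply/subsetP => x xX'; rewrite inE; apply/negP => /(subsetP Y'Y).
  by rewrite inE xX'.
(* When the cap is active, [6 * K <= #|S|] makes [Y] large enough for its rounded half to be
   linear. *)
have c1 : #|S| <= 6 * K * #|X'|.
  rewrite cX'; case: (leqP #|X| #|Y|./2) => _; first by nia.
  have : 6 <= #|Y| by nia.
  by nia.
have c2 : #|S| <= 6 * K * #|Y'| by nia.
have HX' x : x \in X' -> L * #|[set y in Y' | R x y]| <= #|Y'|.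
  move=> xX; have := Hb x (subsetP X'X x xX).
  have : #|[set y in Y' | R x y]| <= #|[set y in Y | R x y]|.
    apply/subset_leq_card/subsetP => y; rewrite !inE => /andP[/(subsetP Y'Y)].
    by rewrite inE => /andP[_ ->] ->.
  by rewrite /R; nia.
rewrite {}/R in HX' HY'.
(* If [b] holds, the rare edges run from [X'] to [Y'], so [Y'] has to come first. *)
by case: b HX' HY' {Hb} => HX' HY'; [exists Y', X'|exists X', Y']; split=> //;
  rewrite disjoint_sym.
Qed.

(* Recurse inside [X] and keep [Y] as the last set; asking for sparsity [L * K]
   of the pair absorbs the loss from shrinking [X]. *)
Lemma exists_sparse_sequence (H : tournament) k L : 0 < L ->
  exists2 K, 0 < K & forall (T : tournament) (S : {set T}), ~ embeds H T -> K <= #|S| ->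
  exists A : nat -> {set T}, (forall i, i < k -> A i \subset S /\ #|S| <= K * #|A i|) /\
    forall i j, i < j < k -> [disjoint A i & A j] /\ sparse L (A i) (A j).
Proof.
move=> L0; elim: k => [|k [K K0 HK]].
  by exists 1 => // T S _ _; exists (fun=> S); split=> // i j; rewrite ltn0 andbF.
have [|K1 K10 HK1] := @exists_sparse_pair H (L * K); first by rewrite muln_gt0 L0.
exists (K1 * K) => [|T S nH leS]; first by rewrite muln_gt0 K10.
have [|X [Y [XS YS dXY [cX cY] [sX sY]]]] := HK1 T S nH.
  by apply: leq_trans leS; rewrite leq_pmulr.
have [|A [HA sA]] := HK T X nH.
  by rewrite -(leq_pmul2l K10) (leq_trans leS).
exists (fun i => if i < k then A i else Y); split=> [i _|i j /andP[ij]].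
  case: ifP => [/HA[AX cA]|_].
    split; first exact: subset_trans XS.
    by rewrite (leq_trans cX) // -mulnA leq_mul2l cA orbT.
  by split=> //; rewrite (leq_trans cY) // leq_mul2r leq_pmulr ?orbT.
rewrite ltnS leq_eqVlt => /orP[/eqP jk|jk]; last first.
  by rewrite jk (ltn_trans ij jk); apply: sA; rewrite ij.
rewrite jk ltnn -jk ij; have [AX cA] := HA i ltac:(by rewrite -jk).
split; first by apply: disjointWl dXY.
split=> [x xA|y yY].
  apply: leq_trans (sX x (subsetP AX x xA)).
  by rewrite leq_mul2r leq_pmulr ?orbT.
have := sY y yY.
have : #|[set x in A i | edge y x]| <= #|[set x in X | edge y x]|.
  by apply/subset_leq_card/subsetP => x; rewrite !inE => /andP[/(subsetP AX)-> ->].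
move=> le leX; rewrite -(leq_pmul2l K0) (leq_trans _ cA) // (leq_trans _ leX) //.
by rewrite mulnA (mulnC K) leq_mul2l le orbT.
Qed.

(** * Embedding nebulas *)

Lemma backward_graph_sym (T : tournament) (theta : seq T) :
  symmetric (backward_graph theta).
Proof. by move=> u v; rewrite /backward_graph orbC. Qed.

(** Brings the component condition into the form that [embed_stars] expects, retaining that the
    centre comes first. *)
Lemma left_nebula_local_star (H : tournament) (theta : seq H) (x : H) :
  left_star theta (component theta x) \/ component theta x = [set x] ->
  (forall v, v != x -> ~~ backward_graph theta x v) \/
  exists c a b, let C := [set c; a; b] in
    [/\ x \in C, uniq [:: c; a; b],
      [/\ backward_graph theta c a, backward_graph theta c b & ~~ backward_graph theta a b],
      forall u v, u \in C -> v \notin C -> ~~ backward_graph theta u v &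
      precedes theta c a /\ precedes theta c b].
Proof.
case=> [[c [[a [b [uniq_cab CE ca cb ab]]] lt]]|C1]; [right|left]; last first.
  move=> v; apply: contraNN => xv.
  by have : v \in component theta x; [rewrite inE connect1 | rewrite C1 inE].
exists c, a, b => C; have Cx : component theta x = C by [].
have [cNa cNb] : a != c /\ b != c.
  by move: uniq_cab => /and3P[]; rewrite !inE negb_or => /andP[]; rewrite ![c == _]eq_sym.
split=> //.
- by rewrite -Cx inE connect0.
- move=> u v; rewrite -Cx !inE => xu; apply: contra => uv.
  by apply: connect_trans xu (connect1 uv).
by split; apply: lt; rewrite Cx !inE ?cNa ?cNb eqxx ?orbT.
Qed.

Lemma robust_starC (T : finType) (adj : rel T) M (X : nat -> {set T}) i j k :
  symmetric adj -> robust_star adj M X i j k -> robust_star adj M X i k j.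
Proof. by move=> adj_sym HX Y YX cY; rewrite has_starC //; apply: HX. Qed.

Lemma robust_star_index (T : finType) (adj : rel T) M (V : finType) (ix : V -> nat)
    (X : nat -> {set T}) c a b (Y : V -> {set T}) :
  0 < M -> injective ix -> robust_star adj M X (ix c) (ix a) (ix b) ->
  (forall v, Y v \subset X (ix v)) -> (forall v, #|X (ix v)| <= M * #|Y v|) ->
  has_star adj (Y c) (Y a) (Y b).
Proof.
move=> M0 ix_inj HX YX cY.
(* Indices outside the image of [ix] keep their set, so [Y'] is a shrinking of the whole family. *)
pose Y' p := if [pick v | ix v == p] is Some v then Y v else X p.
have Y'E v : Y' (ix v) = Y v.
  rewrite /Y'; case: pickP => [w /eqP/ix_inj-> //|/(_ v)].
  by rewrite eqxx.
have := HX Y'; rewrite !Y'E; apply=> p; rewrite /Y'; case: pickP => [v /eqP<-|_] //.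
by rewrite leq_pmull.
Qed.

(** * Backward edges along a sequence of disjoint sets *)

Section Blobs.
Variables (T : tournament) (A : nat -> {set T}) (N L : nat).
Hypothesis A_disjoint : forall i j, i < j < N -> [disjoint A i & A j].
Hypothesis A_sparse : forall i j, i < j < N -> sparse L (A i) (A j).

(** [find] returns [N] on a vertex that lies in none of the sets. *)
Definition blob x := find (fun i => x \in A i) (iota 0 N).

Lemma blobE x i : i < N -> x \in A i -> blob x = i.
Proof.
move=> iN xi; have xhas : has (fun i => x \in A i) (iota 0 N).
  by apply/hasP; exists i; rewrite ?mem_iota.
have ltf : blob x < N by move: xhas; rewrite has_find size_iota.
have xf : x \in A (blob x) by have := nth_find 0 xhas; rewrite nth_iota.
case: (ltngtP (blob x) i) => // lt.
- by have /disjointFl/(_ xi) := A_disjoint (introT andP (conj lt iN)); rewrite xf.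
- by have /disjointFl/(_ xf) := A_disjoint (introT andP (conj lt ltf)); rewrite xi.
Qed.

(** Going through [blob] gives one symmetric relation on all of [T], to which the graph lemmas
    apply. *)
Definition back : rel T := fun x y =>
  (blob x < blob y) && edge y x || (blob y < blob x) && edge x y.

Lemma back_sym : symmetric back.
Proof. by move=> x y; rewrite /back orbC. Qed.

Lemma backE i j x y : i < j < N -> x \in A i -> y \in A j -> back x y = edge y x.
Proof.
move=> /andP[ij jN] xA yA.
by rewrite /back (blobE (ltn_trans ij jN) xA) (blobE jN yA) ij ltnNge (ltnW ij) orbF.
Qed.

Lemma thin_back i j : i < N -> j < N -> i != j -> thin back L (A i) (A j).
Proof.
move=> iN jN; rewrite neq_ltn => /orP[ij|ji] x xA.
  have /A_sparse[/(_ x xA) + _] : i < j < N by rewrite ij.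
  apply: leq_trans; rewrite leq_mul2l subset_leq_card ?orbT //.
  apply/subsetP => y; rewrite !inE => /andP[yA].
  by rewrite (backE (_ : i < j < N) xA yA) ?ij // yA.
have /A_sparse[_ /(_ x xA)] : j < i < N by rewrite ji.
apply: leq_trans; rewrite leq_mul2l subset_leq_card ?orbT //.
apply/subsetP => y; rewrite !inE => /andP[yA]; rewrite back_sym.
by rewrite (backE (_ : j < i < N) yA xA) ?ji // yA.
Qed.

(** A failure of [linked] supplies sets without backward edges between them; in a tournament all
    edges between them then point forward. *)
Lemma linked_back_or_complete E i j : i < j < N -> linked back E (A i) (A j) \/
  exists X Y : {set T}, [/\ X \subset A i, Y \subset A j, #|A i| <= E * #|X|,
    #|A j| <= E * #|Y| & forall x y, x \in X -> y \in Y -> edge x y].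
Proof.
move=> ijN; have [|/existsNP[X /existsNP[Y H]]] := EM (linked back E (A i) (A j)); first by left.
right; exists X, Y; move: H; rewrite !not_implyE => -[XA [YA [cX [cY Hn]]]].
split=> // x y xX yY.
have [xA yA] := (subsetP XA _ xX, subsetP YA _ yY).
have xy : x != y.
  by apply: contraTneq xA => ->; rewrite (disjointFl (A_disjoint ijN) yA).
rewrite (edgeC xy); apply/negP => yx; apply: Hn; exists x, y.
by rewrite (backE ijN xA yA).
Qed.

(** Exactly one of the two possible edges between distinct vertices is present, so one direction per
    pair suffices. *)
Lemma embeds_of_half (G : tournament) (f : G -> T) : injective f ->
  (forall u v, u != v -> edge (f u) (f v) = edge u v \/ edge (f v) (f u) = edge v u) ->
  embeds G T.
Proof.
move=> f_inj Hf; exists f => u v; have [->|uv] := eqVneq u v; first by rewrite !edge_irrefl.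
have [//|e] := Hf u v uv.
by rewrite (edgeC uv) -e; apply: edgeC; rewrite (inj_eq f_inj).
Qed.

Lemma backward_graphE (H : tournament) (theta : seq H) u v :
  precedes theta u v -> backward_graph theta u v = edge v u.
Proof.
move=> uv; rewrite /backward_graph /backward_edge uv andbT orbC.
by rewrite {1}/precedes ltnNge (ltnW uv) andbF orbF.
Qed.

Section Embedding.
Variables (H : tournament) (theta : seq H) (f : H -> T) (ix : H -> nat).
Hypothesis theta_ord : ordering theta.
Hypothesis ix_lt : forall v, ix v < N.
Hypothesis ix_inj : injective ix.
Hypothesis fA : forall v, f v \in A (ix v).
Hypothesis fE : forall u v, u != v -> back (f u) (f v) = backward_graph theta u v.

Lemma blob_embedding_inj : injective f.
Proof. by move=> u v fuv; apply: ix_inj; rewrite -(blobE _ (fA u)) // fuv (blobE _ (fA v)). Qed.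

Lemma precedes_total u v : u != v -> precedes theta u v || precedes theta v u.
Proof.
have th w : w \in theta by rewrite (perm_mem theta_ord) mem_enum.
by rewrite /precedes -neq_ltn; apply: contra => /eqP/(index_inj u (th _) (th _))->.
Qed.

Lemma embeds_of_increasing :
  (forall u v, precedes theta u v -> ix u < ix v) -> embeds H T.
Proof.
move=> mono; apply: (embeds_of_half blob_embedding_inj) => u v uv.
wlog lt : u v uv / precedes theta u v.
  case/orP: (precedes_total uv) => lt; first by apply.
  by rewrite eq_sym in uv => /(_ v u uv lt)[]; [right|left].
right; rewrite -(backward_graphE lt) -fE // (backE _ (fA u) (fA v)) //.
by rewrite mono ?ix_lt.
Qed.

(** Along the reversed order, adjacent pairs again point backward and the others forward, which is
    opposite to their direction in [H]. *)
Lemma embeds_compl_of_decreasing :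
  (forall u v, precedes theta u v -> ix v < ix u) -> embeds (compl H) T.
Proof.
move=> mono; apply: (@embeds_of_half (compl H) f blob_embedding_inj) => u v uv.
wlog lt : u v uv / precedes theta u v.
  case/orP: (precedes_total uv) => lt; first by apply.
  by rewrite eq_sym in uv => /(_ v u uv lt)[]; [right|left].
left; rewrite [RHS](_ : _ = edge (v : H) u) // -(backward_graphE lt) -fE //.
by rewrite back_sym (backE _ (fA v) (fA u)) // mono ?ix_lt.
Qed.

End Embedding.

End Blobs.

Lemma left_nebula_or_complete (H : tournament) : left_nebula H ->
  exists N L D, [/\ 0 < L, 0 < D & forall (T : tournament) (A : nat -> {set T}),
    (forall i, i < N -> 0 < #|A i|) ->
    (forall i j, i < j < N -> [disjoint A i & A j] /\ sparse L (A i) (A j)) ->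
    [\/ embeds H T, embeds (compl H) T |
     exists i j (X Y : {set T}), [/\ i < j < N, X \subset A i /\ #|A i| <= D * #|X|,
       Y \subset A j /\ #|A j| <= D * #|Y| & forall x y, x \in X -> y \in Y -> edge x y]]].
Proof.
move=> [theta theta_ord Hneb].
pose h := #|H|; pose M := 2 ^ h; have M0 : 0 < M by rewrite expn_gt0.
have [N [E [E0 HE]]] := homogeneous_stars h M0.
(* Shrinking the sets by a factor [E] turns thinness [6 * M * E] into the [6 * M] needed by
   [embed_stars]; [3 * (E * M)] is the linkage that [homogeneous_stars] asks for. *)
exists N, (6 * M * E), (3 * (E * M)); split; [lia..|] => T A A0 dsA.
have dA i j ijN := (dsA i j ijN).1; have sA i j ijN := (dsA i j ijN).2.
set adj := back A N; have adj_sym : symmetric adj := back_sym A N.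
have [|npure] := EM (exists i j (X Y : {set T}), [/\ i < j < N, X \subset A i /\ #|A i| <= 3 * (E * M) * #|X|,
       Y \subset A j /\ #|A j| <= 3 * (E * M) * #|Y| & forall x y, x \in X -> y \in Y -> edge x y]).
  by constructor 3.
have linkA i j : i < j -> j < N -> linked adj (3 * (E * M)) (A i) (A j).
  move=> ij jN; have ijN : i < j < N by rewrite ij.
  have [//|[X [Y [? ? ? ? ?]]]] := linked_back_or_complete dA (3 * (E * M)) ijN.
  by case: npure; exists i, j, X, Y.
have thinA := thin_back dA sA.
have [|X [i_ [XA cX mono bound HX]]] := HE T adj A (6 * M * E) adj_sym _ A0 thinA linkA.
  by nia.
have pos_lt u : index u theta < h.
  by rewrite /h cardE -(perm_size theta_ord) index_mem (perm_mem theta_ord) mem_enum.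
have pos_inj : injective (fun u => index u theta).
  have th w : w \in theta by rewrite (perm_mem theta_ord) mem_enum.
  by move=> u v; apply: (index_inj u).
have main (ix : H -> nat) : injective ix -> (forall v, ix v < N) ->
    (forall c a b, precedes theta c a -> precedes theta c b -> a != b ->
      robust_star adj M X (ix c) (ix a) (ix b)) ->
    exists f : H -> T, (forall v, f v \in A (ix v)) /\
      forall u v, u != v -> adj (f u) (f v) = backward_graph theta u v.
  move=> ix_inj ixN Hrob.
  have [||x||f [fX fE]] := @embed_stars T adj H (backward_graph theta)
    (fun v => X (ix v)) M adj_sym (@backward_graph_sym _ theta) M0.
  - by move=> v; have := A0 _ (ixN v); have := cX (ix v); case: #|X _| => //; lia.
  - move=> u v uv x xX; rewrite -(leq_pmul2l E0) (leq_trans _ (cX (ix v))) //.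
    apply: leq_trans (thinA _ _ (ixN u) (ixN v) _ x (subsetP (XA _) _ xX)).
      rewrite mulnA (mulnC E) leq_mul2l subset_leq_card ?orbT //.
      by apply/subsetP => y; rewrite !inE => /andP[/(subsetP (XA _)) yA xy]; apply/andP.
    by apply: contra uv => /eqP/ix_inj->.
  - have [single|[c [a [b [xC uC gC clC [pca pcb]]]]]] := left_nebula_local_star (Hneb x).
      by left.
    right; exists c, a, b; split=> // Y YX cY.
    apply: (robust_star_index M0 ix_inj) YX cY; apply: Hrob => //.
    by move: uC; rewrite /= !inE => /and3P[].
  - by [].
  by exists f; split=> // v; apply: (subsetP (XA _)).
have mono_lt i j : i < j -> j < h -> i_ i < i_ j by move=> ij jh; apply: mono; rewrite ij.
have mono_inj i j : i < h -> j < h -> i_ i = i_ j -> i = j.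
  move=> ih jh ij; case: (ltngtP i j) => // lt.
    by move: (mono_lt _ _ lt jh); rewrite ij ltnn.
  by move: (mono_lt _ _ lt ih); rewrite ij ltnn.
case: HX => HX.
  pose ix v := i_ (index v theta).
  have ix_lt v : ix v < N by apply: bound.
  have ix_inj : injective ix by move=> u v /mono_inj eq_uv; apply: pos_inj; apply: eq_uv.
  have [c a b ca cb ab|f [fA fE]] := main ix ix_inj ix_lt.
    case: (ltngtP (index a theta) (index b theta)) => [lt|lt|/pos_inj abE].
    - by apply: HX; rewrite ?lt ?pos_lt.
    - by apply: robust_starC => //; apply: HX; rewrite ?lt ?pos_lt.
    - by rewrite abE eqxx in ab.
  constructor 1; apply: (embeds_of_increasing dA theta_ord ix_lt ix_inj fA fE) => u v lt.
  exact: mono_lt.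
(* The stars are centred in the last set, so [theta] is read backwards: the centre of a left star
   then lands behind its leaves. *)
pose ix v := i_ (h.-1 - index v theta).
have ix_lt v : ix v < N by apply: bound; have := pos_lt v; lia.
have ix_inj : injective ix.
  move=> u v /mono_inj eq_uv; apply: pos_inj => /=; have := pos_lt u; have := pos_lt v.
  by lia.
have [c a b ca cb ab|f [fA fE]] := main ix ix_inj ix_lt.
  have := pos_lt c; have := pos_lt a; have := pos_lt b; move: ca cb; rewrite /precedes => ca cb pb pa pc.
  case: (ltngtP (index a theta) (index b theta)) => [lt|lt|/pos_inj abE].
  - by apply: robust_starC => //; apply: HX; lia.
  - by apply: HX; lia.
  - by rewrite abE eqxx in ab.
constructor 2; apply: (embeds_compl_of_decreasing dA theta_ord ix_lt ix_inj fA fE) => u v.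
by rewrite /precedes => lt; apply: mono_lt; have := pos_lt u; have := pos_lt v; lia.
Qed.

(** * Complete pairs and transitive subtournaments *)

(** [X] and [Y] are nonempty by the size bounds, and disjoint because [edge] is irreflexive. *)
Definition has_pure_pairs K (T : tournament) := forall S : {set T}, 1 < #|S| ->
  exists X Y : {set T}, [/\ X \subset S, Y \subset S, #|S| <= K * #|X|, #|S| <= K * #|Y| &
    forall x y, x \in X -> y \in Y -> edge x y].

Lemma left_nebula_pure_pairs (H : tournament) : left_nebula H ->
  exists2 K, 1 < K & forall T : tournament,
    ~ embeds H T -> ~ embeds (compl H) T -> has_pure_pairs K T.
Proof.
move=> /left_nebula_or_complete[N [L [D [L0 D0 HD]]]].
have [K K0 HK] := exists_sparse_sequence H N L0.
(* The successor makes the constant exceed 1, so that its logarithm is positive later. *)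
exists (K * D).+1 => [|T nH nHc S S1]; first by rewrite ltnS muln_gt0 K0.
(* For small [S] a single edge is already a linear pair. *)
have [ltSK|leKS] := ltnP #|S| K.
  have [x [y [xS yS xy]]] := card_gt1P S1.
  wlog exy : x y xS yS xy / edge x y.
    move=> IH; have := edge_xor xy; case exy: (edge x y) => /= eyx.
      exact: (IH x y).
    by rewrite eq_sym in xy; apply: (IH y x).
  have le : #|S| <= (K * D).+1 * 1.
    by rewrite muln1 (leq_trans (ltnW ltSK)) // (leq_trans (leq_pmulr K D0)).
  exists [set x], [set y]; rewrite !sub1set !cards1; split=> // u v.
  by rewrite !inE => /eqP-> /eqP->.
have [A [AS dsA]] := HK T S nH leKS.
have A0 i : i < N -> 0 < #|A i|.
  by move=> /AS[_]; case: #|A i| => //; lia.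
have [//|//|[i [j [X [Y [ijN [XA cX] [YA cY] XY]]]]]] := HD T A A0 dsA.
have [ij jN] := andP ijN; have iN := ltn_trans ij jN.
have [AiS ci] := AS i iN; have [AjS cj] := AS j jN.
have cK (B C : {set T}) : #|S| <= K * #|B| -> #|B| <= D * #|C| -> #|S| <= (K * D).+1 * #|C|.
  move=> cS cB; rewrite (leq_trans cS) // (@leq_trans (K * D * #|C|)) //.
    by rewrite -mulnA leq_mul2l cB orbT.
  by rewrite leq_mul2r leqnSn orbT.
exists X, Y; split=> //.
- exact: subset_trans XA AiS.
- exact: subset_trans YA AjS.
- exact: cK cX.
- exact: cK cY.
Qed.

Lemma index_rev (T : eqType) (s : seq T) x : uniq s -> x \in s ->
  index x (rev s) = size s - (index x s).+1.
Proof.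
move=> us xs; have lt : index x s < size s by rewrite index_mem.
have E : size s - (size s - (index x s).+1).+1 = index x s by lia.
rewrite -{1}(nth_index x xs) -{1}E -nth_rev; last by lia.
by rewrite index_uniq ?rev_uniq // size_rev; lia.
Qed.

(** Reversing both the edges and the ordering preserves the backward graph and exchanges right stars
    with left stars. *)
Lemma left_nebula_compl (H : tournament) : right_nebula H -> left_nebula (compl H).
Proof.
move=> [theta theta_ord Hneb]; exists (rev theta : seq (compl H)).
  by rewrite /ordering perm_rev.
have uniq_th : uniq theta by rewrite (perm_uniq theta_ord) enum_uniq.
have mem_th u : u \in theta by rewrite (perm_mem theta_ord) mem_enum.
have precE (u v : H) : @precedes (compl H) (rev theta) u v = precedes theta v u.
  rewrite /precedes !index_rev //.
  have aux n i j : i < n -> j < n -> (n - i.+1 < n - j.+1) = (j < i) by lia.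
  by apply: aux; rewrite index_mem; apply: mem_th.
have backE : @backward_graph (compl H) (rev theta) =2 backward_graph theta.
  by move=> u v; rewrite /backward_graph /backward_edge !precE orbC.
have compE (x : H) : @component (compl H) (rev theta) x = component theta x.
  by apply/setP => y; rewrite !inE (eq_connect backE).
move=> x; rewrite compE; case: (Hneb x) => [[c [[a [b [abc CE ca cb ab]]] lt]]|]; [left|by right].
exists c; split; first by exists a, b; rewrite !backE.
by move=> u /lt; rewrite precE.
Qed.

Lemma nebula_pure_pairs (H : tournament) : left_nebula H \/ right_nebula H ->
  exists2 K, 1 < K & forall T : tournament,
    ~ embeds H T -> ~ embeds (compl H) T -> has_pure_pairs K T.
Proof.
case=> [|/left_nebula_compl] /left_nebula_pure_pairs // [K K1 HK].
(* [compl (compl H)] has the same edges as [H], hence the same embeddings. *)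
by exists K => // T nH nHc; apply: HK => // -[f fE]; apply: nH; exists f => u v; apply: fE.
Qed.

(** Every edge increases the position in [s], so no cycle can close up. *)
Lemma pairwise_transitive (T : tournament) (s : seq T) :
  pairwise (@edge T) s -> transitive_tournament (induced [set x in s]).
Proof.
move=> ps c /andP[cyc _]; case: c cyc => // x p /= pth.
pose r (u : induced [set x in s]) := index (val u) s.
have edge_r : subrel (@edge (induced [set x in s])) (relpre r ltn).
  move=> u v uv; rewrite /= ltnNge leq_eqVlt; apply/negP => /orP[/eqP|lt].
    have mem_s (w : induced [set x in s]) : val w \in s by have := valP w; rewrite inE.
    move=> /(index_inj (val u) (mem_s _) (mem_s _))/val_inj vu.
    by move: uv; rewrite vu edge_irrefl.
  have mem_s (w : induced [set x in s]) : r w < size s by have := valP w; rewrite inE index_mem.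
  have /(pairwiseP (val u))/(_ _ _ (mem_s v) (mem_s u) lt) := ps.
  rewrite !nth_index -?index_mem ?mem_s // => vu.
  by have := edgeC (edge_neq vu); rewrite vu (_ : edge (val u) (val v)).
have tr : transitive (relpre r ltn) by move=> u v w; apply: ltn_trans.
by have := order_path_min tr (sub_path edge_r pth); rewrite all_rcons /= ltnn.
Qed.

(** * The power bound by recursion on complete pairs *)

Section PowerBound.
Local Open Scope ring_scope.
Import Order.TTheory GRing.Theory Num.Theory.

(** Concatenate the sequences found inside [X] and [Y]. As the [kappa]-th power of [K] is at most 2,
    each is at least half as long as the [kappa]-th power of [#|S|]. *)
Lemma pure_pairs_transitive (R : realType) (K : nat) (kappa : R) (T : tournament) :
  (0 < K)%N -> 0 < kappa -> K%:R `^ kappa <= 2 -> has_pure_pairs K T ->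
  forall S : {set T}, exists s : seq T,
    [/\ pairwise (@edge T) s, {subset s <= S} & #|S|%:R `^ kappa <= (size s)%:R].
Proof.
move=> K0 kappa0 leK2 HT S.
have [n] := ubnP #|S|; elim: n => // n IHn in S *; rewrite ltnS => leSn.
have [S1|] := ltnP 1 #|S|; last first.
  rewrite leq_eqVlt => /orP[/eqP S1|].
    have /card_gt0P[x xS] : (0 < #|S|)%N by rewrite S1.
    exists [:: x]; split=> //; first by move=> y; rewrite inE => /eqP->.
    by rewrite S1 powR1.
  rewrite ltnS leqn0 => /eqP S0; exists [::]; split=> //.
  by rewrite S0 powR0 // gt_eqF.
have [X [Y [XS YS cX cY XY]]] := HT S S1.
have irr x : x \in X -> x \notin Y.
  by move=> xX; apply/negP => /(XY _ _ xX); rewrite edge_irrefl.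
have X0 : (0 < #|X|)%N by case: #|X| cX; lia.
have Y0 : (0 < #|Y|)%N by case: #|Y| cY; lia.
(* Being disjoint and nonempty, both sets are smaller than [S], so the induction applies. *)
have XYS : (#|X| + #|Y| <= #|S|)%N.
  rewrite -cardsUI (_ : X :&: Y = set0) ?cards0 ?addn0.
    by rewrite subset_leq_card // subUset XS.
  by apply/setP => x; rewrite !inE; apply/negP => /andP[/irr/negP].
have [|s [ps sX les]] := IHn X; first by lia.
have [|t [pt tY let_]] := IHn Y; first by lia.
exists (s ++ t); split.
- rewrite pairwise_cat ps pt !andbT; apply/allrelP => x y /sX xX /tY yY; exact: XY.
- move=> x; rewrite mem_cat => /orP[/sX|/tY]; [exact: (subsetP XS)|exact: (subsetP YS)].
have half (Z : {set T}) (u : seq T) : (#|S| <= K * #|Z|)%N ->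
    #|Z|%:R `^ kappa <= (size u)%:R :> R -> #|S|%:R `^ kappa <= 2 * (size u)%:R.
  move=> cZ leZ; apply: le_trans (_ : (K * #|Z|)%:R `^ kappa <= _).
    by apply: ge0_ler_powR; rewrite ?nnegrE ?ler0n ?ler_nat // ltW.
  rewrite natrM powRM ?ler0n //; apply: ler_pM => //; exact: powR_ge0.
have hs := half X s cX les; have ht := half Y t cY let_.
rewrite size_cat natrD -(ler_pM2l (ltr0n R 2)) mulrDr.
by rewrite mulr_natl mulr2n lerD.
Qed.

End PowerBound.

Theorem mainTheorem2 (R : realType) (H : tournament) :
  left_nebula H \/ right_nebula H ->
  erdos_hajnal R (fun S => S = H \/ S = compl H).
Proof.
move=> /nebula_pure_pairs[K K1 HK].
have lnK_gt0 : (0 < ln (K%:R : R))%R by apply: ln_gt0; rewrite Num.Theory.ltr1n.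
have ln2 : (0 < ln (2 : R))%R by apply: ln_gt0; rewrite Num.Theory.ltr1n.
have kappa0 : (0 < ln (2 : R) / ln (K%:R : R))%R by rewrite Num.Theory.divr_gt0.
(* The exponent for which the power of [K] is exactly 2. *)
exists (ln (2 : R) / ln (K%:R : R))%R => // T nT.
have noH G : G = H \/ G = compl H -> ~ embeds G T.
  by move=> HG /embeds_contains; apply: nT.
have pureT : has_pure_pairs K T by apply: HK; apply: noH; [left|right].
have powK : (K%:R `^ (ln 2 / ln K%:R) <= 2 :> R)%R.
  (* [powR] treats base 0 separately; the positive logarithm of [K] excludes that case. *)
  rewrite /powR; case: eqP => [K0|_].
    by move: lnK_gt0; rewrite K0 ln0 // Order.POrderTheory.ltxx.
  rewrite GRing.divfK ?Order.POrderTheory.gt_eqF // lnK ?Order.POrderTheory.lexx //.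
  by rewrite Num.Theory.posrE Num.Theory.ltr0n.
have [s [ps _ les]] := pure_pairs_transitive (ltnW K1) kappa0 powK pureT [set: T].
exists [set x in s]; split; first exact: pairwise_transitive.
rewrite cardsT in les; rewrite (_ : #|induced [set x in s]| = size s) //.
rewrite card_sig cardsE; apply/card_uniqP.
exact: pairwise_uniq (@edge_irrefl T) ps.
Qed.
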